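(* For every positive integer $n$ there exists a non-discrete Tychonoff topology $\tau_W^n$ on the semigroup $\mathscr{IO}_{\infty}(\mathbb{Z}^n_{\mathrm{lex}})$ such that $(\mathscr{IO}_{\infty}(\mathbb{Z}^n_{\mathrm{lex}}),\tau_W^n)$ is a topological inverse semigroup.
   Context: $L_n=\{1,\ldots,n\}$ with its usual order; $L_n\times_{\mathrm{lex}}\mathbb{Z}$ is $L_n\times\mathbb{Z}$ with the lexicographic order: $(i,m)\leqslant(j,l)$ iff $i<j$, or $i=j$ and $m\le l$. $\mathscr{IO}_{\infty}(\mathbb{Z}^n_{\mathrm{lex}})$ is the inverse monoid of all injective partial maps $\alpha$ from $L_n\times\mathbb{Z}$ to itself that are monotone ($x\leqslant y$ in $\operatorname{dom}\alpha$ implies $(x)\alpha\leqslant(y)\alpha$) and such that both $\operatorname{dom}\alpha$ and $\operatorname{ran}\alpha$ have finite complement in $L_n\times\mathbb{Z}$; the operation is composition of partial maps written on the right, $(x)(\alpha\beta)=((x)\alpha)\beta$. A topological inverse semigroup is an inverse semigroup with a Hausdorff topology for which the multiplication is jointly continuous and the inversion $x\mapsto x^{-1}$ is continuous. Tychonoff means completely regular and Hausdorff. *)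

(* Defs.v *)
From mathcomp Require Import all_boot all_order all_algebra.
From mathcomp Require Import all_classical all_reals all_analysis.

Set Implicit Arguments.
Unset Strict Implicit.
Unset Printing Implicit Defensive.

Import Order.TTheory.
Local Open Scope classical_set_scope.

Section PartialMaps.
Context {X : Type}.
Implicit Types f g : X -> option X.

Definition pdom f : set X := [set x | isSome (f x)].

Definition pran f : set X := [set y | exists x, f x = Some y].

Definition pinjective f : Prop :=
  forall x y z, f x = Some z -> f y = Some z -> x = y.

(* Maps are written on the right: [f] is applied first. *)
Definition pmul f g : X -> option X := fun x => obind g (f x).

Lemma pmul_SomeP f g x z :
  pmul f g x = Some z <-> exists2 y, f x = Some y & g y = Some z.
Proof.
rewrite /pmul; split; last by case=> y -> /=.
by case: (f x) => //= y gyz; exists y.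
Qed.

Lemma pinjective_pmul f g :
  pinjective f -> pinjective g -> pinjective (pmul f g).
Proof.
move=> fI gI x y z /pmul_SomeP[u fxu guz] /pmul_SomeP[v fyv gvz].
by apply: (fI _ _ u) => //; rewrite fyv (gI _ _ _ guz gvz).
Qed.

Lemma cofinite_pdom_pmul f g : pinjective f ->
  cofinite_set (pdom f) -> cofinite_set (pdom g) ->
  cofinite_set (pdom (pmul f g)).
Proof.
move=> fI fdom gdom.
have fin : finite_set (f @^-1` (Some @` (~` pdom g))).
  apply: finite_preimage; last exact: finite_image.
  move=> x y /set_mem[u _ fxu] _ fxy.
  by apply: (fI _ _ u); rewrite ?fxu // -fxy fxu.
apply: (@sub_finite_set _ _ (~` pdom f `|` f @^-1` (Some @` (~` pdom g)))).
  move=> x; rewrite /pdom /pmul /=; case fx: (f x) => [y|] /= gy; last by left.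
  by right; exists y.
by rewrite finite_setU.
Qed.

Lemma cofinite_pran_pmul f g :
  cofinite_set (pran f) -> cofinite_set (pran g) ->
  cofinite_set (pran (pmul f g)).
Proof.
move=> fran gran.
pose B : set X := [set z | exists2 y, (~` pran f) y & g y = Some z].
have fin : finite_set B.
  apply: (@sub_finite_set _ _ (Some @^-1` (g @` (~` pran f)))).
    by move=> z [y fy gyz]; exists y.
  by apply: finite_preimage; [move=> x y _ _ []|exact: finite_image].
apply: (@sub_finite_set _ _ (~` pran g `|` B)); last by rewrite finite_setU.
move=> z nz; have [[y gyz]|] := pselect (pran g z); last by left.
right; exists y => // -[x fxy]; apply: nz; exists x.
by apply/pmul_SomeP; exists y.
Qed.

End PartialMaps.

(* [L_n] is represented by ['I_n] = {0, ..., n-1}; [*l] is the product type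
   carrying the lexicographic order. *)
Definition lexZ (n : nat) := ('I_n *l int)%type.

Lemma lexZ_leE n (x y : lexZ n) :
  (x <= y)%O = (x.1 < y.1)%N || (x.1 == y.1) && (x.2 <= y.2)%R.
Proof.
rewrite leEprodlexi !leEord -val_eqE /=.
by case: ltngtP => //=.
Qed.

Record IO (n : nat) := mkIO {
  io_fun :> lexZ n -> option (lexZ n) ;
  io_inj : pinjective io_fun ;
  io_mono : forall x y x' y' : lexZ n,
    io_fun x = Some x' -> io_fun y = Some y' -> (x <= y)%O -> (x' <= y')%O ;
  io_dom : cofinite_set (pdom io_fun) ;
  io_ran : cofinite_set (pran io_fun)
}.

Lemma io_ext n (a b : IO n) : io_fun a =1 io_fun b -> a = b.
Proof.
case: a b => [f fI fm fd fr] [g gI gm gd gr] /= /funext fg.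
by subst g; congr mkIO; exact: Prop_irrelevance.
Qed.

Lemma io_mul_mono n (a b : IO n) (x y x' y' : lexZ n) :
  pmul a b x = Some x' -> pmul a b y = Some y' -> (x <= y)%O -> (x' <= y')%O.
Proof.
move=> /pmul_SomeP[u au bu] /pmul_SomeP[v av bv] xy.
exact: io_mono bu bv (io_mono au av xy).
Qed.

Definition io_mul n (a b : IO n) : IO n :=
  mkIO (pinjective_pmul (@io_inj n a) (@io_inj n b))
       (@io_mul_mono n a b)
       (cofinite_pdom_pmul (@io_inj n a) (io_dom a) (io_dom b))
       (cofinite_pran_pmul (io_ran a) (io_ran b)).

Definition inverse_of S (mul : S -> S -> S) (x y : S) : Prop :=
  mul (mul x y) x = x /\ mul (mul y x) y = y.

Definition inverse_semigroup S (mul : S -> S -> S) : Prop :=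
  associative mul /\ forall x, exists! y, inverse_of mul x y.

(* The function [inv] below is unique, so it is the inversion of the inverse
   semigroup. *)
Definition topological_inverse_semigroup (T : topologicalType)
    (mul : T -> T -> T) : Prop :=
  [/\ inverse_semigroup mul,
      hausdorff_space T,
      continuous (fun p : T * T => mul p.1 p.2) &
      exists2 inv : T -> T,
        forall x, inverse_of mul x (inv x) & continuous inv].

(* By [uniform_separatorP], [completely_regular_space] is the separation of
   points from closed sets by continuous real-valued functions; it does not
   include the Hausdorff axiom. *)
Definition tychonoff_space (T : topologicalType) : Prop :=
  completely_regular_space T /\ hausdorff_space T.

Definition discrete_space (T : topologicalType) : Prop :=
  forall A : set T, open A.

(* Main.v *)
Require Import Defs.
From HB Require Import structures.
From mathcomp Require Import all_boot all_order all_algebra.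
From mathcomp Require Import all_classical all_reals all_analysis.
From mathcomp Require Import Rstruct.

(** The topology is the one of pointwise convergence of a partial map and of
    its inverse, with values in the discrete space [option (lexZ n)].  Since
    [x(ab)] is determined by [a] at [x] and by [b] at the point [xa], the
    multiplication is jointly continuous; inversion only swaps the two
    families of coordinates.  The topology comes from a uniformity, so it is
    completely regular.  It is not discrete: the identity restricted to the
    complement of a point converges to the identity when that point escapes
    every finite set. *)

Set Implicit Arguments.
Unset Strict Implicit.
Unset Printing Implicit Defensive.

Import Order.TTheory.
Local Open Scope classical_set_scope.

(** Reduces equality of partial maps to equality of their graphs, the form in which an inverse is
    easy to handle: its graph is the transposed one. *)
Lemma option_ext T (u v : option T) :
  (forall x, u = Some x <-> v = Some x) -> u = v.
Proof.
case: u v => [x|] [y|] // uv; first exact/esym/uv.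
- by have := (uv x).1 erefl.
- by have := (uv y).2 erefl.
Qed.

(** * Inverses of injective partial maps *)

Section PartialInverse.
Context {X : Type}.
Implicit Types f g : X -> option X.

(** Membership in the range is decided classically and a preimage is chosen, so [pinv] is total in
    [f]; it is a genuine inverse once [f] is injective. *)
Definition pinv f : X -> option X := fun y =>
  if pselect (pran f y) is left fy then Some (projT1 (cid fy)) else None.

Lemma pinv_SomeP f x y : pinjective f -> pinv f y = Some x <-> f x = Some y.
Proof.
move=> fI; rewrite /pinv; case: pselect => [fy|nfy].
  case: cid => /= z fz; split=> [[<-]//|fx].
  by rewrite (fI _ _ _ fz fx).
by split=> // fx; case: nfy; exists x.
Qed.

Lemma pinjective_pinv f : pinjective f -> pinjective (pinv f).
Proof.
move=> fI x y z /(pinv_SomeP _ _ fI) fx /(pinv_SomeP _ _ fI).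
by rewrite fx => -[].
Qed.

Lemma pdom_pinv f : pinjective f -> pdom (pinv f) = pran f.
Proof.
move=> fI; apply/seteqP; split=> y; last first.
  by move=> [x /(pinv_SomeP _ _ fI) fy]; rewrite /pdom /= fy.
rewrite /pdom /=; case E: (pinv f y) => [x|//] _.
by exists x; apply/(pinv_SomeP _ _ fI).
Qed.

Lemma pran_pinv f : pinjective f -> pran (pinv f) = pdom f.
Proof.
move=> fI; apply/seteqP; split=> [x [y /(pinv_SomeP _ _ fI) fx]|x].
  by rewrite /pdom /= fx.
rewrite /pdom /=; case fx: (f x) => [y|//] _.
by exists y; apply/(pinv_SomeP _ _ fI).
Qed.

Lemma pmulA : associative (@pmul X).
Proof. by move=> f g h; apply: funext => x; rewrite /pmul; case: (f x). Qed.

Lemma pmul_pinvK f : pinjective f -> pmul (pmul f (pinv f)) f = f.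
Proof.
move=> fI; apply: funext => x; rewrite /pmul.
by case fx: (f x) => [y|//] /=; rewrite ((pinv_SomeP _ _ fI).2 fx).
Qed.

Lemma pinv_pmulK f : pinjective f -> pmul (pmul (pinv f) f) (pinv f) = pinv f.
Proof.
move=> fI; apply: funext => y; rewrite /pmul.
by case fy: (pinv f y) => [x|//] /=; rewrite ((pinv_SomeP _ _ fI).1 fy).
Qed.

(** Evaluating [fgf = f] at [x] forces [g] to be defined at [y], with a value that [f] sends to [y];
    injectivity identifies this value with [x]. Applied to both equations of [inverse_of], this
    makes inverses unique. *)
Lemma pmul_inverse_SomeP f g x y : pinjective f ->
  pmul (pmul f g) f = f -> f x = Some y -> g y = Some x.
Proof.
move=> fI /(congr1 (@^~ x)) + fx; rewrite /pmul fx /=.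
by case: (g y) => [z|//] /= fz; rewrite (fI _ _ _ fz fx).
Qed.

Lemma pinv_pmul f g : pinjective f -> pinjective g ->
  pinv (pmul f g) = pmul (pinv g) (pinv f).
Proof.
move=> fI gI; apply: funext => z; apply: option_ext => x.
rewrite (pinv_SomeP _ _ (pinjective_pmul fI gI)) !pmul_SomeP; split.
  by move=> [y fx gy]; exists y; apply/pinv_SomeP.
by move=> [y /(pinv_SomeP _ _ gI) ? /(pinv_SomeP _ _ fI) ?]; exists y.
Qed.

End PartialInverse.

(** * The inverse semigroup structure *)

Section InverseSemigroup.
Variable n : nat.
Implicit Types a b : IO n.

(** The order is total: if [y' < x'], monotonicity of [a] gives [y <= x], hence [x = y] and
    [x' = y'], a contradiction. *)
Lemma io_inv_mono a (x y x' y' : lexZ n) :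
  pinv a x = Some x' -> pinv a y = Some y' -> (x <= y)%O -> (x' <= y')%O.
Proof.
move=> /(pinv_SomeP _ _ (@io_inj _ a)) ax /(pinv_SomeP _ _ (@io_inj _ a)) ay xy.
case: leP => // yx'; have yx := io_mono ay ax (ltW yx').
have exy : x = y by apply: le_anti; rewrite xy yx.
have ey : y' = x' by apply: io_inj ax; rewrite exy.
by move: yx'; rewrite ey ltxx.
Qed.

Lemma io_inv_dom a : cofinite_set (pdom (pinv a)).
Proof. by rewrite pdom_pinv; [exact: io_ran|exact: io_inj]. Qed.

Lemma io_inv_ran a : cofinite_set (pran (pinv a)).
Proof. by rewrite pran_pinv; [exact: io_dom|exact: io_inj]. Qed.

Definition io_inv a : IO n :=
  mkIO (pinjective_pinv (@io_inj n a)) (@io_inv_mono a)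
       (io_inv_dom a) (io_inv_ran a).

Lemma io_invK : involutive io_inv.
Proof.
move=> a; apply: io_ext => x; apply: option_ext => y /=.
rewrite pinv_SomeP; last exact: pinjective_pinv (@io_inj _ a).
by rewrite pinv_SomeP //; exact: io_inj.
Qed.

Lemma io_invM a b : io_inv (io_mul a b) = io_mul (io_inv b) (io_inv a).
Proof. by apply: io_ext => x /=; rewrite pinv_pmul //; exact: io_inj. Qed.

Lemma io_mulA : associative (@io_mul n).
Proof. by move=> a b c; apply: io_ext => x /=; rewrite pmulA. Qed.

Lemma inverse_of_io_inv a : inverse_of (@io_mul n) a (io_inv a).
Proof.
split; apply: io_ext => x /=; first by rewrite pmul_pinvK //; exact: io_inj.
by rewrite pinv_pmulK //; exact: io_inj.
Qed.

Lemma inverse_of_io_inv_uniq a b : inverse_of (@io_mul n) a b -> b = io_inv a.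
Proof.
move=> [/(congr1 (@io_fun n)) /= aba /(congr1 (@io_fun n)) /= bab].
apply: io_ext => y; apply: option_ext => x /=.
rewrite pinv_SomeP; last exact: io_inj.
by split; apply: pmul_inverse_SomeP => //; exact: io_inj.
Qed.

Lemma io_inverse_semigroup : inverse_semigroup (@io_mul n).
Proof.
split=> [|a]; first exact: io_mulA.
exists (io_inv a); split=> [|b ab]; first exact: inverse_of_io_inv.
exact/esym/inverse_of_io_inv_uniq.
Qed.

End InverseSemigroup.

(** * The uniformity of pointwise agreement on finite sets *)

HB.instance Definition _ n := gen_eqMixin (IO n).
HB.instance Definition _ n := gen_choiceMixin (IO n).

Section Uniformity.
Variable n : nat.
Implicit Types (a b c : IO n) (s t : seq (lexZ n)).

(** The basic entourages. Comparing the inverses as well makes the relation invariant under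
    inversion. *)
Definition agree s a b :=
  forall x, x \in s -> a x = b x /\ io_inv a x = io_inv b x.

Lemma agree_sym s a b : agree s a b -> agree s b a.
Proof. by move=> ab x /ab[-> ->]. Qed.

Lemma agree_trans s b a c : agree s a b -> agree s b c -> agree s a c.
Proof. by move=> ab bc x xs; have [-> ->] := ab x xs; exact: bc. Qed.

Lemma agree_cat s t a b : agree (s ++ t) a b <-> agree s a b /\ agree t a b.
Proof.
split=> [ab|[sab tab] x]; last by rewrite mem_cat => /orP[/sab|/tab].
by split=> x xst; apply: ab; rewrite mem_cat xst ?orbT.
Qed.

Lemma agree_inv s a b : agree s a b -> agree s (io_inv a) (io_inv b).
Proof. by move=> ab x /ab[? ?]; rewrite !io_invK. Qed.

(** On [s], the product reads [a] on [s] and [b] on the image of [s] under [a]; its inverse reads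
    [b^-1] on [s] and [a^-1] on the image of [s] under [b^-1]. Both enlarged lists are finite and
    depend on [a] and [b] only. *)
Lemma agree_mul s a a' b b' :
  agree (s ++ pmap (io_inv b) s) a a' -> agree (s ++ pmap a s) b b' ->
  agree s (io_mul a b) (io_mul a' b').
Proof.
move=> /agree_cat[saa taa] /agree_cat[sbb tbb] x xs.
have mem_pmap_Some (f : IO n) y : f x = Some y -> y \in pmap f s.
  by move=> fx; rewrite mem_pmap -fx; exact: map_f.
have [ax iax] := saa x xs; have [bx ibx] := sbb x xs.
rewrite !io_invM /= /pmul; split.
  rewrite -ax; case E: (a x) => [y|//] /=.
  by have [] := tbb y (mem_pmap_Some _ _ E).
(* Folding [pinv b'] into [io_inv b'] lets the agreement of the inverses at [x] apply. *)
rewrite -[pinv b' x]/(io_inv b' x) -ibx /=; case E: (pinv b x) => [y|//] /=.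
by have [] := taa y (mem_pmap_Some (io_inv b) _ E).
Qed.

Local Open Scope relation_scope.

Definition io_ent : set_system (IO n * IO n) :=
  [set A | exists s, forall a b, agree s a b -> A (a, b)].

Lemma io_ent_filter : Filter io_ent.
Proof.
split=> [|A B [s sA] [t tB]|A B AB [s sA]]; first by exists [::].
  by exists (s ++ t) => a b /agree_cat[/sA ? /tB].
by exists s => a b /sA; exact: AB.
Qed.

Lemma io_ent_refl A : io_ent A -> diagonal `<=` A.
Proof. by move=> [s sA] [a b] /diagonalP ->; exact: sA. Qed.

Lemma io_ent_inv A : io_ent A -> io_ent A^-1.
Proof. by move=> [s sA]; exists s => a b /agree_sym /sA. Qed.

(** Agreement on [s] is transitive, so the basic entourage of [s] is its own square root. *)
Lemma io_ent_split A : io_ent A -> exists2 B, io_ent B & B \; B `<=` A.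
Proof.
move=> [s sA]; exists [set p | agree s p.1 p.2]; first by exists s.
by move=> [a c] [b /= ab bc]; apply: sA; exact: agree_trans ab bc.
Qed.

End Uniformity.

HB.instance Definition _ n := @isUniform.Build (IO n) (@io_ent n)
  (@io_ent_filter n) (@io_ent_refl n) (@io_ent_inv n) (@io_ent_split n).

(** * Hausdorff separation and continuity of the operations *)

Section Topology.
Variable n : nat.
Implicit Types (a b : IO n) (s : seq (lexZ n)).

Lemma nbhs_ioP a (A : set (IO n)) :
  nbhs a A <-> exists s, forall b, agree s a b -> A b.
Proof.
rewrite -nbhs_entourageE; split=> [[E [s sE] EA]|[s sA]].
  by exists s => b /sE ab; apply/EA/mem_set.
exists [set p | agree s p.1 p.2]; first by exists s.
by move=> b /xsectionP /sA.
Qed.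

Lemma nbhs_agree s a : nbhs a (agree s a).
Proof. by apply/nbhs_ioP; exists s. Qed.

Lemma io_hausdorff : hausdorff_space (IO n).
Proof.
move=> a b ab; apply: io_ext => x.
(* Neighbourhoods of [a] and [b] always meet; a common element [c] has at [x] the values of both. *)
have [c [ac bc]] := ab _ _ (nbhs_agree [:: x] a) (nbhs_agree [:: x] b).
by have [-> _] := ac x (mem_head _ _); have [-> _] := bc x (mem_head _ _).
Qed.

Lemma io_mul_continuous : continuous (fun p : IO n * IO n => io_mul p.1 p.2).
Proof.
move=> [a b] A /nbhs_ioP[s sA].
exists (agree (s ++ pmap (io_inv b) s) a, agree (s ++ pmap a s) b).
  by split; exact: nbhs_agree.
by move=> [a' b'] [/= aa bb]; apply: sA; exact: agree_mul.
Qed.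

Lemma io_inv_continuous : continuous (@io_inv n).
Proof.
move=> a A /nbhs_ioP[s sA]; apply/nbhs_ioP.
by exists s => b /agree_inv /sA.
Qed.

End Topology.

(** * Idempotents converging to the identity *)

Section NotDiscrete.
Variable n : nat.
Implicit Types (p x y : lexZ n) (H : set (lexZ n)).

(** [H] is the set of removed points, so that a finite [H] yields an element of the semigroup. *)
Definition prestrict_id H x := if pselect (H x) then None else Some x.

Lemma prestrict_idP H x y : prestrict_id H x = Some y <-> x = y /\ ~ H x.
Proof.
rewrite /prestrict_id; case: pselect => Hx; split=> //; first by case.
- by case=> <-.
- by case=> xy _; congr Some.
Qed.

Lemma prestrict_id_inj H : pinjective (prestrict_id H).
Proof. by move=> x y z /prestrict_idP[-> _] /prestrict_idP[-> _]. Qed.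

Lemma prestrict_id_mono H x y x' y' : prestrict_id H x = Some x' ->
  prestrict_id H y = Some y' -> (x <= y)%O -> (x' <= y')%O.
Proof. by move=> /prestrict_idP[-> _] /prestrict_idP[-> _]. Qed.

Lemma pdom_prestrict_id H : pdom (prestrict_id H) = ~` H.
Proof.
by apply/seteqP; split=> x; rewrite /pdom /prestrict_id /=; case: pselect.
Qed.

Lemma pran_prestrict_id H : pran (prestrict_id H) = ~` H.
Proof.
apply/seteqP; split=> x; first by move=> [y /prestrict_idP[<-]].
by move=> Hx; exists x; apply/prestrict_idP.
Qed.

Lemma cofinite_pdom_prestrict_id H :
  finite_set H -> cofinite_set (pdom (prestrict_id H)).
Proof. by rewrite pdom_prestrict_id setCK. Qed.

Lemma cofinite_pran_prestrict_id H :
  finite_set H -> cofinite_set (pran (prestrict_id H)).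
Proof. by rewrite pran_prestrict_id setCK. Qed.

Definition io_restrict_id H (finH : finite_set H) : IO n :=
  mkIO (@prestrict_id_inj H) (@prestrict_id_mono H)
       (cofinite_pdom_prestrict_id finH) (cofinite_pran_prestrict_id finH).

Lemma io_inv_restrict_id H (finH : finite_set H) :
  io_inv (io_restrict_id finH) = io_restrict_id finH.
Proof.
apply: io_ext => x; apply: option_ext => y /=.
rewrite pinv_SomeP ?prestrict_idP; last exact: prestrict_id_inj.
by split=> -[->].
Qed.

Lemma lexZ_notin (s : seq (lexZ n)) : (0 < n)%N -> exists x, x \notin s.
Proof.
move=> n0; pose f (m : nat) : lexZ n := (Ordinal n0, m%:Z)%R.
have fI : injective f by move=> i j [].
apply/not_existsP => sP.
(* Pigeonhole: otherwise [s] would contain [size s + 1] distinct points of one copy of the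
   integers. *)
have : (size [seq f m | m <- iota 0 (size s).+1] <= size s)%N.
  apply: uniq_leq_size; first by rewrite map_inj_uniq ?iota_uniq.
  by move=> x _; apply: contrapT => /negP /sP.
by rewrite size_map size_iota ltnn.
Qed.

Lemma io_not_discrete : (0 < n)%N -> ~ discrete_space (IO n).
Proof.
move=> n0 discr; pose e := io_restrict_id (@finite_set0 (lexZ n)).
(* If the identity [e] were isolated, its values on some finite list [s] would determine it. *)
have /nbhs_ioP[s] : nbhs e [set e] by apply: open_nbhs_nbhs; split.
have [p ps] := lexZ_notin s n0.
move=> /(_ (io_restrict_id (finite_set1 p))) ag.
(* Removing [p], which lies outside [s], is invisible on [s], yet the two maps differ at [p]. *)
have /(congr1 (fun a : IO n => a p)) /= : io_restrict_id (finite_set1 p) = e.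
  apply: ag => x xs; rewrite !io_inv_restrict_id /=.
  suff -> : prestrict_id set0 x = prestrict_id [set p] x by [].
  apply: option_ext => y; rewrite !prestrict_idP.
  by split=> -[xy _]; split=> // xp; rewrite -[p]xp xs in ps.
have -> : prestrict_id set0 p = Some p by apply/prestrict_idP; split.
by move=> /prestrict_idP[_]; apply.
Qed.

End NotDiscrete.

Theorem mainTheorem12 (n : nat) (n_gt0 : (0 < n)%N) :
  exists c : Topological.axioms_ (IO n),
    let T : topologicalType := Topological.Pack c in
    [/\ ~ discrete_space T, tychonoff_space T &
        @topological_inverse_semigroup T (@io_mul n)].
Proof.
exists (Topological.class (IO n)); split.
- exact: io_not_discrete.
- split; last exact: io_hausdorff.
  (* Every uniform space is completely regular; a concrete model of the reals is supplied for the
     argument. *)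
  exact: (@uniform_completely_regular Rdefinitions.R (IO n)).
- split; [exact: io_inverse_semigroup|exact: io_hausdorff| |].
    exact: io_mul_continuous.
  exists (@io_inv n); [exact: inverse_of_io_inv|exact: io_inv_continuous].
Qed.
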